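(* Let $u\in\Delta_d$ be a prior and let $\hat R(\beta)$ be the training risk of base predictor $\beta\in\{X_1,\dots,X_d\}$. For $\lambda>0$ consider the Gibbs posterior $$\hat\theta_\lambda=\arg\min_{\theta\in\Delta_d}\Big(\mathbb{E}_{\beta\sim\theta}[\hat R(\beta)]+\lambda D_{\mathrm{KL}}(\theta,u)\Big),$$ and consider exponentiated gradient descent $\tilde\theta_{t+1}=\theta_t\odot\exp(-\eta_t\nabla f(\theta_t))$, $\theta_{t+1}=\tilde\theta_{t+1}/\|\tilde\theta_{t+1}\|_1$, applied to the linear loss $f(\theta)=\mathbb{E}_{\beta\sim\theta}[\hat R(\beta)]$, with constant step sizes $\eta_t=\eta>0$, $t=0,1,2,\dots$, and initialization $\theta_0=u$. Then for $\lambda=1/(\eta T)$ (with $T\ge1$ an integer), these two estimators coincide: $\hat\theta_\lambda=\theta_T$.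
   Context: $X_1,\dots,X_d\in\mathbb{R}^n$ are base predictors, $Y\in\mathbb{R}^n$ a response vector, $\ell$ an arbitrary loss function. For $\theta\in\Delta_d=\{a\in\mathbb{R}^d:a_i\ge0,\ \sum_ia_i=1\}$, $\beta\sim\theta$ denotes the randomized predictor that equals $X_j$ with probability $\theta_j$. The training risk is $\hat R(\beta)=\frac1n\sum_{i=1}^n\ell(\beta(X)_i,Y_i)$, where $\beta(X)=X_j$ when the $j$th predictor is drawn; thus $\mathbb{E}_{\beta\sim\theta}[\hat R(\beta)]=\sum_{j=1}^d\theta_j\hat R(X_j)$ (expectation only over the draw of $\beta$). $D_{\mathrm{KL}}(a,b)=\sum_{i=1}^da_i\log(a_i/b_i)$ (with $0\log0=0$, and value $+\infty$ if $a_i>0=b_i$ for some $i$). $\odot$ is coordinatewise multiplication and $\exp$ acts coordinatewise. *)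

(* Defs.v *)
From mathcomp Require Import all_boot all_order all_algebra.
From mathcomp Require Import all_classical all_reals all_analysis.

Set Implicit Arguments.
Unset Strict Implicit.
Unset Printing Implicit Defensive.

Import Order.TTheory GRing.Theory Num.Theory numFieldNormedType.Exports.

Local Open Scope classical_set_scope.
Local Open Scope ring_scope.

Definition simplex (R : realType) (d : nat) : set 'rV[R]_d :=
  [set a | (forall i, 0 <= a 0 i) /\ \sum_i a 0 i = 1].
Arguments simplex : clear implicits.

Definition training_risk (R : realType) (n : nat) (l : R -> R -> R)
    (Y beta : 'rV[R]_n) : R :=
  n%:R^-1 * \sum_i l (beta 0 i) (Y 0 i).

(* The expectation of g over the randomized predictor equal to X j with
   probability theta_j. It is given on all of R^d, as a linear function of
   theta, so that it can be differentiated in every coordinate direction. *)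
Definition expect (R : realType) (n d : nat) (X : 'I_d -> 'rV[R]_n)
    (theta : 'rV[R]_d) (g : 'rV[R]_n -> R) : R :=
  \sum_j theta 0 j * g (X j).

Definition expected_risk (R : realType) (n d : nat) (l : R -> R -> R)
    (X : 'I_d -> 'rV[R]_n) (Y : 'rV[R]_n) (theta : 'rV[R]_d) : R :=
  expect X theta (training_risk l Y).

(* a log (a / b), with 0 log (0 / b) = 0 for every b (including b = 0) and
   a log (a / 0) = +oo for a <> 0. *)
Definition KL_term (R : realType) (a b : R) : \bar R :=
  if a == 0 then 0%E else if b == 0 then +oo%E else (a * ln (a / b))%:E.

Definition KL (R : realType) (d : nat) (a b : 'rV[R]_d) : \bar R :=
  (\sum_i KL_term (a 0%R i) (b 0%R i))%E.

Definition argmin (R : realType) (T : Type) (A : set T) (F : T -> \bar R) :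
    set T :=
  [set x | A x /\ forall y, A y -> (F x <= F y)%E].

Definition gibbs_posterior (R : realType) (n d : nat) (l : R -> R -> R)
    (X : 'I_d -> 'rV[R]_n) (Y : 'rV[R]_n) (u : 'rV[R]_d) (lambda : R) :
    set 'rV[R]_d :=
  argmin (simplex R d)
    (fun theta => (expected_risk l X Y theta)%:E + lambda%:E * KL theta u)%E.

Definition gradient (R : realType) (d : nat) (f : 'rV[R]_d -> R)
    (theta : 'rV[R]_d) : 'rV[R]_d :=
  \row_i 'D_(delta_mx 0 i) f theta.

(* The library norm on 'rV[R]_d is the sup norm. *)
Definition norm1 (R : realType) (d : nat) (v : 'rV[R]_d) : R :=
  \sum_i `|v 0 i|.

Definition egd_step (R : realType) (d : nat) (f : 'rV[R]_d -> R) (eta : R)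
    (theta : 'rV[R]_d) : 'rV[R]_d :=
  let w := map2_mx *%R theta (map_mx expR (- eta *: gradient f theta)) in
  (norm1 w)^-1 *: w.

Fixpoint egd (R : realType) (d : nat) (f : 'rV[R]_d -> R) (eta : nat -> R)
    (theta0 : 'rV[R]_d) (t : nat) : 'rV[R]_d :=
  if t is s.+1 then egd_step f (eta s) (egd f eta theta0 s) else theta0.

(* Main.v *)
Require Import Defs.
From mathcomp Require Import all_boot all_order all_algebra.
From mathcomp Require Import all_classical all_reals all_analysis.
From mathcomp Require Import ring.

(** Both sides are one explicit object, the exponential tilt of the prior:
    the point of the simplex proportional to u_i exp (- eta T g_i), where g_i
    is the training risk of X_i.

    On the descent side, the expected risk is linear with gradient g at every
    point, so one step of exponentiated gradient descent is a tilt by eta g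
    ([egd_step_tilt]). Tilts compose additively because the normalizing
    constants telescope ([tiltD]), hence T steps amount to a single tilt by
    eta T g ([egd_linear]).

    On the Gibbs side, let p be the tilt of u by g / lambda, with normalizing
    constant Z. Taking logarithms in the definition of p gives
      lambda KL(x, p) = <x, g> + lambda KL(x, u) + lambda ln Z
    on the simplex ([KL_tilt]), so that the Gibbs objective and KL(x, p) have
    the same minimizers; by Gibbs' inequality p is the only one
    ([argmin_KL], [argmin_linear_KL]). For lambda = 1 / (eta T) the two tilts
    agree.

    Coordinates with u_i = 0 need no separate treatment: p has the same zeros
    as u, so both divergences are infinite at the same x and the identity
    holds in the extended reals. *)

Import Order.TTheory GRing.Theory Num.Theory numFieldNormedType.Exports.

Local Open Scope classical_set_scope.
Local Open Scope ring_scope.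

(** * The relative entropy on the simplex *)

Lemma KL_termxx {R : realType} (a : R) : KL_term a a = 0%E.
Proof.
by rewrite /KL_term; case: eqVneq => // a0; rewrite divff// ln1 mulr0.
Qed.

(** Unlike KL_term itself, which may be negative, its excess over the linear
    term a - b is nonnegative for each coordinate separately; and the linear
    terms cancel when summed over two points of the simplex. *)
Lemma KL_term_gt {R : realType} {a b : R} :
  0 <= a -> 0 <= b -> a != b -> ((a - b)%:E < KL_term a b)%E.
Proof.
move=> a0 b0 ab; rewrite /KL_term.
case: (eqVneq a 0) ab => [->|an0] ab.
  by rewrite lte_fin sub0r oppr_lt0 lt_neqAle ab.
case: (eqVneq b 0) ab => [->|bn0] ab; first exact: ltry.
have {a0 an0} a0 : 0 < a by rewrite lt_neqAle eq_sym an0.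
have {b0 bn0} b0 : 0 < b by rewrite lt_neqAle eq_sym bn0.
(* This is 1 + x < exp x at x = ln (b / a), multiplied by a. *)
have x0 : ln (b / a) != 0.
  rewrite ln_eq0 ?divr_gt0//; apply: contra ab => /eqP ba.
  by rewrite eq_sym -subr_eq0 -[b](divfK (lt0r_neq0 a0)) ba mul1r subrr.
have := expR_gt1Dx x0; rewrite lnK ?posrE ?divr_gt0// -(ltr_pM2l a0).
rewrite [a * (b / a)]mulrC divfK ?gt_eqF// mulrDr mulr1 => ineq.
rewrite lte_fin -[a / b]invf_div lnV ?posrE ?divr_gt0// mulrN.
by rewrite ltrBlDr addrC ltrBrDr.
Qed.

(** Gibbs' inequality with its equality case: KL(x, p) is a sum of nonnegative
    excesses, each of which vanishes only when the two coordinates agree. *)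
Lemma argmin_KL {R : realType} {d : nat} {p : 'rV[R]_d} :
  simplex R d p -> argmin (simplex R d) (fun x => KL x p) = [set p].
Proof.
move=> hp.
have KLpp : KL p p = 0%E by rewrite /KL big1// => i _; exact: KL_termxx.
have excess x : simplex R d x ->
    KL x p = (\sum_i (KL_term (x 0%R i) (p 0%R i) - (x 0 i - p 0 i)%:E))%E.
  move=> hx; under [RHS]eq_bigr do rewrite -EFinN.
  by rewrite big_split /= sumEFin sumrN sumrB hx.2 hp.2 subrr oppr0 adde0.
have excess_ge0 x : simplex R d x -> forall i,
    (0 <= KL_term (x 0%R i) (p 0%R i) - (x 0 i - p 0 i)%:E)%E.
  move=> hx i; rewrite sube_ge0//.
  have [->|ne] := eqVneq (x 0 i) (p 0 i); first by rewrite KL_termxx subrr.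
  exact/ltW/(KL_term_gt (hx.1 i) (hp.1 i) ne).
apply/seteqP; split => [x [hx /(_ p hp)]|x ->]; last first.
  split=> // y hy; rewrite KLpp excess//.
  by apply: sume_ge0 => i _; exact: excess_ge0.
rewrite KLpp excess// => le0; apply/rowP => i.
apply/eqP; apply: contraT => ne.
have : (\sum_i (KL_term (x 0%R i) (p 0%R i) - (x 0 i - p 0 i)%:E) == 0)%E.
  by rewrite eq_le le0 sume_ge0// => j _; exact: excess_ge0.
rewrite seq_psume_eq0; last by move=> j _; exact: excess_ge0.
move=> /allP/(_ i (mem_index_enum i)) /=.
by rewrite gt_eqF// EFinN sube_gt0 KL_term_gt ?hx.1 ?hp.1.
Qed.

(** * Exponential tilting *)

Definition partition_sum {R : realType} {d : nat} (u s : 'rV[R]_d) : R :=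
  \sum_i u 0 i * expR (- s 0 i).

Definition tilt {R : realType} {d : nat} (u s : 'rV[R]_d) : 'rV[R]_d :=
  \row_i (u 0 i * expR (- s 0 i) / partition_sum u s).

Lemma partition_sum_gt0 {R : realType} {d : nat} {u : 'rV[R]_d} (s : 'rV[R]_d) :
  simplex R d u -> 0 < partition_sum u s.
Proof.
move=> hu; have ge0 i : 0 <= u 0 i * expR (- s 0 i).
  by rewrite mulr_ge0 ?hu.1 ?expR_ge0.
rewrite lt_neqAle eq_sym sumr_ge0// andbT psumr_eq0//.
apply/negP => /allP u0.
have := hu.2; rewrite big1 => [/eqP|i _]; first by rewrite eq_sym oner_eq0.
have := u0 i (mem_index_enum i).
by rewrite /= mulf_eq0 (gt_eqF (expR_gt0 _)) orbF => /eqP.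
Qed.

Lemma tilt_simplex {R : realType} {d : nat} {u : 'rV[R]_d} (s : 'rV[R]_d) :
  simplex R d u -> simplex R d (tilt u s).
Proof.
move=> hu; have Z0 := partition_sum_gt0 s hu; split=> [i|].
  by rewrite mxE divr_ge0 ?(ltW Z0)// mulr_ge0 ?hu.1 ?expR_ge0.
under eq_bigr do rewrite mxE.
by rewrite -mulr_suml divff ?gt_eqF.
Qed.

Lemma tilt0 {R : realType} {d : nat} {u : 'rV[R]_d} :
  simplex R d u -> tilt u 0 = u.
Proof.
move=> hu; have e0 i : u 0 i * expR (- (0 : 'rV[R]_d) 0 i) = u 0 i.
  by rewrite mxE oppr0 expR0 mulr1.
have Z1 : partition_sum u 0 = 1.
  by rewrite /partition_sum; under eq_bigr do rewrite e0; exact: hu.2.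
by apply/rowP => i; rewrite mxE e0 Z1 divr1.
Qed.

(** The normalizing constant of u tilted by s cancels between the numerator and
    the normalizing constant of the second tilt. *)
Lemma tiltD {R : realType} {d : nat} {u : 'rV[R]_d} (s v : 'rV[R]_d) :
  simplex R d u -> tilt (tilt u s) v = tilt u (s + v).
Proof.
move=> hu; have Zs0 := partition_sum_gt0 s hu.
have wE i : tilt u s 0 i * expR (- v 0 i) =
    u 0 i * expR (- (s + v) 0 i) / partition_sum u s.
  by rewrite !mxE opprD expRD mulrA mulrAC.
have ZE : partition_sum (tilt u s) v =
    partition_sum u (s + v) / partition_sum u s.
  rewrite /partition_sum; under eq_bigr do rewrite wE.
  by rewrite -mulr_suml.
apply/rowP => i; rewrite [LHS]mxE wE ZE [RHS]mxE invf_div.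
by rewrite mulrA divfK ?gt_eqF.
Qed.

(** Changing the reference from u to its tilt adds x_i (s_i + ln Z) to each
    term of the divergence, also where u vanishes and the term is infinite;
    the constants ln Z add up to one ln Z since x has total mass 1. *)
Lemma KL_tilt {R : realType} {d : nat} {u a : 'rV[R]_d} (s : 'rV[R]_d) :
  simplex R d u -> simplex R d a ->
  KL a (tilt u s) =
  (KL a u + (\sum_i a 0 i * s 0 i + ln (partition_sum u s))%:E)%E.
Proof.
move=> hu ha; have Z0 := partition_sum_gt0 s hu.
set L := ln _.
have -> : \sum_i a 0 i * s 0 i + L = \sum_i a 0 i * (s 0 i + L).
  under [RHS]eq_bigr do rewrite mulrDr.
  by rewrite big_split /= -mulr_suml ha.2 mul1r.
rewrite -sumEFin -big_split /=; apply: eq_bigr => i _.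
rewrite /KL_term mxE; case: eqVneq => [->|an0]; first by rewrite mul0r adde0.
have a0 : 0 < a 0 i by rewrite lt_neqAle eq_sym an0 ha.1.
case: (eqVneq (u 0 i) 0) => [->|un0]; first by rewrite !mul0r eqxx.
have u0 : 0 < u 0 i by rewrite lt_neqAle eq_sym un0 hu.1.
have e0 := expR_gt0 (- s 0 i).
rewrite gt_eqF ?divr_gt0 ?mulr_gt0//= -EFinD -mulrDr; congr (_ * _)%:E.
rewrite !ln_div ?posrE ?divr_gt0 ?mulr_gt0//.
by rewrite lnM ?posrE// expRK /L; ring.
Qed.

(** The Gibbs variational principle: up to the additive constant lambda ln Z,
    the regularized linear objective is lambda times the divergence from the
    tilted prior. *)
Lemma argmin_linear_KL {R : realType} {d : nat} {u : 'rV[R]_d}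
    (g : 'rV[R]_d) {lambda : R} :
  simplex R d u -> 0 < lambda ->
  argmin (simplex R d)
    (fun x => (\sum_i x 0 i * g 0 i)%:E + lambda%:E * KL x u)%E
  = [set tilt u (lambda^-1 *: g)].
Proof.
move=> hu l0; set p := tilt u _; have hp : simplex R d p by exact: tilt_simplex.
set F := (F in argmin _ F).
set c := lambda * ln (partition_sum u (lambda^-1 *: g)).
have FE x : simplex R d x -> (lambda%:E * KL x p = F x + c%:E)%E.
  move=> hx; rewrite KL_tilt// muleDr ?fin_num_adde_defl// -EFinM mulrDr.
  rewrite mulr_sumr EFinD addeA.
  congr (_ + _)%E; rewrite addeC; congr (_%:E + _)%E.
  by apply: eq_bigr => i _; rewrite mxE mulrCA mulVKf// gt_eqF.
have FKL x y : simplex R d x -> simplex R d y ->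
    (F x <= F y)%E = (KL x p <= KL y p)%E.
  by move=> hx hy; rewrite -(@leeD2rE _ c%:E)// -!FE// lee_pmul2l ?lte_fin.
rewrite -(argmin_KL hp); apply/seteqP; split=> x [hx le]; split=> // y hy.
  by rewrite -FKL// le.
by rewrite FKL// le.
Qed.

(** * Exponentiated gradient descent on a linear loss *)

Lemma gradient_linear {R : realType} {d : nat} (g theta : 'rV[R]_d) :
  gradient (fun x : 'rV[R]_d => \sum_j x 0 j * g 0 j) theta = g.
Proof.
apply/rowP => i; rewrite mxE /derive.
(* The difference quotient is constant away from h = 0. *)
apply: lim_near_cst => //; near=> h.
have h0 : h != 0 by near: h; exact: nbhs_dnbhs_neq.
rewrite /= -sumrB (bigD1 i)//= big1 => [|j ji]; last first.
  by rewrite !mxE eqxx (negbTE ji) mulr0 add0r subrr.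
rewrite !mxE !eqxx mulr1 addr0 mulrDl addrK.
by rewrite /GRing.scale /= mulrA mulVf// mul1r.
Unshelve. all: by end_near.
Qed.

Lemma egd_step_tilt {R : realType} {d : nat} (f : 'rV[R]_d -> R) (eta : R)
    {theta : 'rV[R]_d} :
  simplex R d theta ->
  egd_step f eta theta = tilt theta (eta *: gradient f theta).
Proof.
move=> hth; rewrite /egd_step; set w := map2_mx _ _ _.
have wE i : w 0 i = theta 0 i * expR (- (eta *: gradient f theta) 0 i).
  by rewrite !mxE mulNr.
have -> : norm1 w = partition_sum theta (eta *: gradient f theta).
  apply: eq_bigr => i _.
  by rewrite wE ger0_norm// mulr_ge0 ?hth.1 ?expR_ge0.
by apply/rowP => i; rewrite [RHS]mxE -wE mxE mulrC.
Qed.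

Lemma egd_linear {R : realType} {d : nat} {u : 'rV[R]_d} (g : 'rV[R]_d)
    (eta : R) (t : nat) :
  simplex R d u ->
  egd (fun x : 'rV[R]_d => \sum_j x 0 j * g 0 j) (fun=> eta) u t
  = tilt u ((eta * t%:R) *: g).
Proof.
move=> hu; elim: t => [|t IH]; first by rewrite mulr0 scale0r tilt0.
rewrite [LHS]/= IH egd_step_tilt; last exact: tilt_simplex.
by rewrite gradient_linear tiltD// -scalerDl -natr1 mulrDr mulr1.
Qed.

Theorem proposition5 (R : realType) (n d : nat) (hn : (0 < n)%N)
    (l : R -> R -> R) (X : 'I_d -> 'rV[R]_n) (Y : 'rV[R]_n)
    (u : 'rV[R]_d) (hu : simplex R d u)
    (eta : R) (heta : 0 < eta) (T : nat) (hT : (1 <= T)%N)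
    (lambda : R) (hlambda : lambda = 1 / (eta * T%:R)) :
  gibbs_posterior l X Y u lambda
  = [set egd (expected_risk l X Y) (fun=> eta) u T].
Proof.
pose g : 'rV[R]_d := \row_j training_risk l Y (X j).
have riskE : expected_risk l X Y = fun x => \sum_j x 0 j * g 0 j.
  by apply/funext => x; apply: eq_bigr => j _; rewrite mxE.
have l0 : 0 < lambda.
  by rewrite hlambda divr_gt0 ?mulr_gt0 ?ltr0n.
rewrite /gibbs_posterior riskE argmin_linear_KL// egd_linear//.
by rewrite hlambda div1r invrK.
Qed.
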